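(* Let $d\ge1$, $\gamma>0$, and suppose that $F(q)=\mathbb{M}q$ for all $q\in\mathbb{R}^d$, where $\mathbb{M}$ is a real $d\times d$ normal matrix, i.e. $\mathbb{M}\mathbb{M}^{\dagger}=\mathbb{M}^{\dagger}\mathbb{M}$. Then the dynamics $$\frac{\mathrm{d}q_t}{\mathrm{d}t}=p_t,\qquad \frac{\mathrm{d}p_t}{\mathrm{d}t}=-F(q_t)-\gamma p_t$$ is asymptotically stable if and only if $F$ satisfies the following assumption: there exist a non-negative function $U\in\mathcal{C}^{4}(\mathbb{R}^{d},\mathbb{R})$, a vector field $\ell\in\mathcal{C}^{3}(\mathbb{R}^{d},\mathbb{R}^{d})$ and constants $\alpha\in(0,\infty)$, $\beta\in(0,\gamma)$ such that $F=\nabla U+\ell$ and $$\langle F(q),q\rangle\ \ge\ \alpha\left(|q|^{2}+U(q)\right)+\frac{|\ell(q)|^{2}}{\beta^{2}}\qquad\text{for all }q\in\mathbb{R}^{d}.$$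
   Context: $\mathbb{M}^{\dagger}$ is the transpose of $\mathbb{M}$. The dynamics $X_t=(q_t,p_t)\in\mathbb{R}^{2d}$ is called asymptotically stable if for every initial point $X_0=x\in\mathbb{R}^{2d}$ one has $\lim_{t\to\infty}X_t=(0,0)$ (for linear $F$, local and global asymptotic stability coincide). *)

(* Defs.v *)
From HB Require Import structures.
From mathcomp Require Import all_boot all_order all_algebra.
From mathcomp Require Import all_classical all_reals all_analysis.

Set Implicit Arguments.
Unset Strict Implicit.
Unset Printing Implicit Defensive.

Import Order.TTheory GRing.Theory Num.Theory.
Import numFieldNormedType.Exports.

Local Open Scope classical_set_scope.
Local Open Scope ring_scope.

Definition dotv (R : realType) (d : nat) (u v : 'cV[R]_d) : R :=
  \sum_(i < d) u i 0 * v i 0.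

(* The Euclidean norm: the library norm on matrices is the sup norm, which
   induces the same topology and the same derivatives. *)
Definition enorm (R : realType) (d : nat) (u : 'cV[R]_d) : R :=
  Num.sqrt (dotv u u).

(* The domain is finite-dimensional, so the derivative of f is a C^k map into
   the linear maps iff each of its directional evaluations is C^k. *)
Fixpoint Ck (R : realType) (d : nat) (W : normedModType R) (k : nat)
    (f : 'cV[R]_d -> W) : Prop :=
  if k is k'.+1 then
    (forall x, differentiable f x) /\ (forall v, Ck k' (fun x => 'D_v f x))
  else continuous f.

Definition grad (R : realType) (d : nat) (U : 'cV[R]_d -> R)
    (q : 'cV[R]_d) : 'cV[R]_d :=
  \col_i 'D_(delta_mx i 0) (U : 'cV[R]_d -> R^o) q.

(* X t = (q_t, p_t) for t >= 0; values at t < 0 are irrelevant.  Continuity on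
   [0, +oo) together with the equations on (0, +oo) gives the equations at 0
   for the right derivative when F is continuous. *)
Definition trajectory (R : realType) (d : nat) (F : 'cV[R]_d -> 'cV[R]_d)
    (gamma : R) (X : R -> 'cV[R]_d * 'cV[R]_d) : Prop :=
  {within `[0, +oo[, continuous X} /\
  forall t : R, 0 < t ->
    is_derive (t : R^o) 1 (fun s : R^o => (X s).1) (X t).2 /\
    is_derive (t : R^o) 1 (fun s : R^o => (X s).2)
      (- F (X t).1 - gamma *: (X t).2).

Definition asymptotically_stable (R : realType) (d : nat)
    (F : 'cV[R]_d -> 'cV[R]_d) (gamma : R) : Prop :=
  forall (x : 'cV[R]_d * 'cV[R]_d) (X : R -> 'cV[R]_d * 'cV[R]_d),
    trajectory F gamma X -> X 0 = x ->
    X t @[t --> +oo] --> ((0, 0) : 'cV[R]_d * 'cV[R]_d).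

Definition force_assumption (R : realType) (d : nat)
    (F : 'cV[R]_d -> 'cV[R]_d) (gamma : R) : Prop :=
  exists (U : 'cV[R]_d -> R) (l : 'cV[R]_d -> 'cV[R]_d) (alpha beta : R),
    [/\ (forall q, 0 <= U q),
        Ck 4 (U : 'cV[R]_d -> R^o) /\ Ck 3 l,
        0 < alpha /\ 0 < beta < gamma,
        (forall q, F q = grad U q + l q) &
        forall q, dotv (F q) q >=
          alpha * (enorm q ^+ 2 + U q) + enorm (l q) ^+ 2 / beta ^+ 2].

(* Main.v *)
Require Import Defs.
From HB Require Import structures.
From mathcomp Require Import all_boot all_order all_algebra.
From mathcomp Require Import all_classical all_reals all_analysis.
From mathcomp Require Import complex ring lra.

Import Order.TTheory GRing.Theory Num.Theory.
Import numFieldNormedType.Exports.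

Local Open Scope classical_set_scope.
Local Open Scope ring_scope.

Set Implicit Arguments.
Unset Strict Implicit.
Unset Printing Implicit Defensive.

(** Write M = S + A with S symmetric and A antisymmetric.  Both conditions of
    the theorem say that every complex eigenvalue a + ib of M satisfies
    b ^ 2 < gamma ^ 2 * a; for normal M this is the statement that the
    quadratic form gamma ^ 2 <S q, q> - |A q| ^ 2 is positive definite.

    The force assumption implies stability for every force field, linear or
    not ([force_assumption_stable]).  With p = q', the energy
      H = U(q) + |p|^2 / 2 + gamma / 2 <q, p> + gamma ^ 2 / 4 |q|^2
    has along trajectories the derivative
      - <l(q), p> - gamma / 2 |p|^2 - gamma / 2 <F(q), q>,
    from which <grad U, p> has disappeared.  The assumption bounds <F(q), q>
    below, and beta < gamma is what lets the two last terms absorb <l(q), p>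
    with something to spare, so H' <= - lam H and H decays exponentially.
    Since H dominates |p|^2 and |q|^2, the trajectory tends to 0.

    Conversely, let z = x + iy be an eigenvector of M for a + ib.  If
    gamma ^ 2 * a <= b ^ 2, then X ^ 2 + gamma X + (a + ib) has a root
    s + iw with s >= 0 ([unstable_char_root]), and the real and imaginary parts
    of exp((s + iw) t) z are two solutions whose squared norms add up to
    exp(2 s t) |z|^2 ([spiral_trajectory], [spiral_growth]); they cannot both
    tend to 0, so stability excludes such an eigenvalue ([stable_spectrum]).
    The unitary diagonalization of the normal matrix M, read over the reals
    ([normal_real_spectral]), turns the eigenvalue inequalities into a quadratic
    form inequality ([normal_coercive]); it says that U(q) = <q, M q> / 2 and
    l(q) = A q satisfy the force assumption. *)

(** * The Euclidean inner product *)

Section DotProduct.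
Variables (R : realType) (d : nat).
Implicit Types (u v w : 'cV[R]_d) (k : R) (M : 'M[R]_d).

Lemma dotvE u v : dotv u v = (u^T *m v) 0 0.
Proof. by rewrite mxE; apply: eq_bigr => i _; rewrite mxE. Qed.

Lemma dotvC u v : dotv u v = dotv v u.
Proof. by apply: eq_bigr => i _; rewrite mulrC. Qed.

Lemma dotvDr u v w : dotv u (v + w) = dotv u v + dotv u w.
Proof. by rewrite !dotvE mulmxDr mxE. Qed.

Lemma dotvZr k u v : dotv u (k *: v) = k * dotv u v.
Proof. by rewrite !dotvE -scalemxAr mxE. Qed.

Lemma dotvNr u v : dotv u (- v) = - dotv u v.
Proof. by rewrite -scaleN1r dotvZr mulN1r. Qed.

Lemma dotvDl u v w : dotv (v + w) u = dotv v u + dotv w u.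
Proof. by rewrite ![dotv _ u]dotvC dotvDr. Qed.

Lemma dotvZl k u v : dotv (k *: u) v = k * dotv u v.
Proof. by rewrite dotvC dotvZr dotvC. Qed.

Lemma dotvNl u v : dotv (- u) v = - dotv u v.
Proof. by rewrite dotvC dotvNr dotvC. Qed.

Lemma dotv_mulmxr M u v : dotv u (M *m v) = dotv (M^T *m u) v.
Proof. by rewrite !dotvE trmx_mul trmxK mulmxA. Qed.

Lemma dotv_delta i u : dotv (delta_mx i 0) u = u i 0.
Proof.
rewrite /dotv (bigD1 i) //= big1 ?addr0 => [|j ji]; last first.
  by rewrite mxE (negbTE ji) mul0r.
by rewrite mxE !eqxx mul1r.
Qed.

Lemma dotv_ge0 u : 0 <= dotv u u.
Proof. by apply: sumr_ge0 => i _; rewrite -expr2 sqr_ge0. Qed.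

Lemma enorm_sqr u : enorm u ^+ 2 = dotv u u.
Proof. by rewrite sqr_sqrtr ?dotv_ge0. Qed.

End DotProduct.

(** * Calculus on column vectors *)

Lemma linear_continuous_cV (R : realType) (d : nat) (W : normedModType R)
    (f : {linear 'cV[R]_d -> W}) : continuous f.
Proof.
have -> : (f : 'cV[R]_d -> W) = fun q => \sum_j q j 0 *: f (delta_mx j 0).
  apply/funext => q; rewrite {1}(matrix_sum_delta q) linear_sum.
  by apply: eq_bigr => j _; rewrite big_ord1 linearZ.
move=> q; apply: (@cvg_big _ _ _ _ _ _ _ (nbhs q)) => [|j _].
  exact: add_continuous.
have := @coord_continuous R d 1 j 0 q.
exact: (@cvgZr_tmp _ _ _ (nbhs q) _ _ _ (f (delta_mx j 0))).
Qed.

Arguments linear_continuous_cV {R d W} f x.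

Lemma Ck_cst (R : realType) (d : nat) (W : normedModType R) (k : nat) (c : W) :
  Ck k (cst c : 'cV[R]_d -> W).
Proof.
elim: k c => [|k IH] c /=; first exact: cst_continuous.
split=> [x|v]; first exact: differentiable_cst.
rewrite (_ : (fun x => _) = cst 0); first exact: IH.
by apply/funext => x; rewrite derive_cst.
Qed.

Lemma Ck_linear (R : realType) (d : nat) (W : normedModType R) (k : nat)
    (f : {linear 'cV[R]_d -> W}) : Ck k f.
Proof.
have fc := linear_continuous_cV f.
case: k => [|k] //=; split=> [x|v]; first exact: linear_differentiable.
rewrite (_ : (fun x => _) = cst (f v)); first exact: Ck_cst.
apply/funext => x; rewrite deriveE; last exact: linear_differentiable.
by rewrite diff_lin.
Qed.

(** Vector-valued curves are differentiated entry by entry, which reduces the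
    equations of motion to calculus in one real variable. *)
Lemma is_derive_mxP (R : realFieldType) (V : normedModType R) (m n : nat)
    (f : V -> 'M[R]_(m, n)) (df : 'M[R]_(m, n)) (t v : V) :
  is_derive t v f df <->
  forall i j, is_derive t v (fun s => f s i j : R^o) (df i j).
Proof.
split=> [[fd <-] i j|fd].
  by apply: DeriveDef; [exact: (derivable_mxP f t v).1|rewrite derive_mx // mxE].
have fdd : derivable f t v.
  by apply/derivable_mxP => i j; have [] := fd i j.
apply: DeriveDef => //; apply/matrixP => i j.
by rewrite derive_mx // mxE; have [_ ->] := fd i j.
Qed.

Lemma is_derive_dotv (R : realType) (V : normedModType R) (d : nat)
    (u w : V -> 'cV[R]_d) (du dw : 'cV[R]_d) (t v : V) :
  is_derive t v u du -> is_derive t v w dw ->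
  is_derive t v (fun s => dotv (u s) (w s) : R^o) (dotv du (w t) + dotv (u t) dw).
Proof.
move=> /is_derive_mxP ud /is_derive_mxP wd.
have h i := is_deriveM (ud i 0) (wd i 0).
rewrite (_ : (fun s => _) =
    \sum_i ((fun s => u s i 0) * (fun s => w s i 0) : V -> R^o)).
  apply: is_derive_eq (is_derive_sum h) _.
  rewrite /dotv -big_split; apply: eq_bigr => i _ /=.
  by rewrite /GRing.scale /= addrC [du i 0 * _]mulrC.
by apply/funext => s; rewrite fct_sumE.
Qed.

Lemma is_derive_mull (R : realType) (k t : R) :
  is_derive (t : R^o) 1 (( *%R k) : R^o -> R^o) k.
Proof.
rewrite (_ : ( *%R k) = k *: (id : R^o -> R^o)) //.
by apply: is_derive_eq; rewrite /GRing.scale /= mulr1.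
Qed.

Section QuadraticForm.
Variables (R : realType) (d : nat) (M : 'M[R]_d).

Definition quad (q : 'cV[R]_d) : R := 2^-1 * dotv q (M *m q).

(** The directional derivative of the quadratic form along v.  It is linear in q,
    so the quadratic form is C^k for every k. *)
Let dquad (v q : 'cV[R]_d) : R^o := dotv (2^-1 *: (M *m v + M^T *m v)) q.

Let dquad_linear v : linear (dquad v).
Proof. by move=> a p q; rewrite /dquad dotvDr dotvZr. Qed.

HB.instance Definition _ v := GRing.isLinear.Build R 'cV[R]_d R^o _ (dquad v)
  (@dquad_linear v).

Lemma differentiable_quad q : differentiable (quad : 'cV[R]_d -> R^o) q.
Proof.
rewrite (_ : quad = 2^-1 *: \sum_i ((fun p : 'cV[R]_d => p i 0)
   * (fun p => (mulmx M p) i 0) : 'cV[R]_d -> R)); last first.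
  by apply/funext => p; rewrite /quad /= fct_sumE.
apply: differentiableZ; apply: differentiable_sum => i.
apply: differentiableM; first exact: differentiable_coord.
apply: (@differentiable_comp _ _ _ _ (mulmx M) (fun p : 'cV[R]_d => p i 0)).
  by apply: linear_differentiable; exact: linear_continuous_cV.
exact: differentiable_coord.
Qed.

Lemma derive_quad v q : 'D_v (quad : 'cV[R]_d -> R^o) q = dquad v q.
Proof.
have dM : is_derive q v (mulmx M) (M *m v).
  have Md : differentiable (mulmx M) q.
    by apply: linear_differentiable; exact: linear_continuous_cV.
  apply: DeriveDef; first exact: diff_derivable.
  by rewrite deriveE // diff_lin //; exact: linear_continuous_cV.
have [_ ->] : is_derive q v (quad : 'cV[R]_d -> R^o)
    (2^-1 * (dotv v (M *m q) + dotv q (M *m v))).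
  exact: (is_deriveZ 2^-1 (is_derive_dotv (is_derive_id q v) dM)).
rewrite /dquad dotvZl dotvDl [in RHS]addrC; congr (_ * (_ + _)).
  by rewrite dotv_mulmxr.
by rewrite dotvC.
Qed.

Lemma Ck_quad k : Ck k (quad : 'cV[R]_d -> R^o).
Proof.
case: k => [|k] /=.
  by move=> q; apply: differentiable_continuous; exact: differentiable_quad.
split=> [|v]; first exact: differentiable_quad.
rewrite (_ : (fun x => _) = dquad v); last first.
  by apply/funext => x; rewrite derive_quad.
exact: (Ck_linear k (dquad v)).
Qed.

Lemma grad_quad q : grad quad q = 2^-1 *: (M *m q + M^T *m q).
Proof.
apply/matrixP => i j; rewrite ord1 mxE derive_quad /dquad.
rewrite dotvZl dotvDl -{1}[M]trmxK -!dotv_mulmxr !dotv_delta.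
by rewrite !mxE addrC.
Qed.

End QuadraticForm.

(** * The force assumption implies stability *)

(** A nonnegative function with H' <= - lam H decays like exp(- lam t), because
    H t * exp(lam t) is nonincreasing.  The comparison starts at time 1,
    inside the open half-line on which H is differentiable. *)
Lemma gronwall_cvg0 (R : realType) (lam : R) (H dH : R -> R) :
  0 < lam ->
  (forall t, 0 < t -> is_derive (t : R^o) 1 (H : R^o -> R^o) (dH t)) ->
  (forall t, 0 < t -> dH t <= - lam * H t) ->
  (forall t, 0 < t -> 0 <= H t) ->
  H t @[t --> +oo] --> 0.
Proof.
move=> lam0 dHt dHle H0.
pose G (t : R) : R := H t * expR (lam * t).
have dG t : 0 < t -> is_derive (t : R^o) 1 (G : R^o -> R^o)
    ((dH t + lam * H t) * expR (lam * t)).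
  move=> t0.
  have he := is_derive1_comp (is_derive_expR (lam * t)) (is_derive_mull lam t).
  apply: is_derive_eq (is_deriveM (dHt t t0) he) _.
  by rewrite /GRing.scale /=; ring.
have Gle t : 1 <= t -> G t <= G 1.
  apply: (@ler0_derive1_nincry R G 1) => //.
  - move=> x; rewrite in_itv andbT /= => x1.
    by have [] := dG x (lt_trans ltr01 x1).
  - move=> x; rewrite in_itv andbT /= => x1.
    have x0 := lt_trans ltr01 x1.
    rewrite derive1E; have [_ ->] := dG x x0.
    rewrite pmulr_lle0 ?expR_gt0 //; have := dHle x x0; lra.
  - apply: continuous_in_subspaceT => x; rewrite inE /= in_itv andbT /= => x1.
    apply: (@differentiable_continuous _ R^o); apply/derivable1_diffP.
    by have [] := dG x (lt_le_trans ltr01 x1).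
have lim : expR (- t) @[t --> +oo] --> (0 : R) by exact: cvgr_expR.
have lam_oo : lam * t @[t --> +oo] --> +oo.
  by apply: gt0_cvgMry => //; exact: cvg_id.
have limG : G 1 * expR (- (lam * t)) @[t --> +oo] --> (0 : R).
  rewrite -(mulr0 (G 1)); apply: cvgMl_tmp.
  exact: (@cvg_comp _ _ _ (fun t => lam * t) (fun u : R => expR (- u))
    _ _ _ lam_oo lim).
apply: (@squeeze_cvgr _ _ _ _ (cst 0) _ _ _ _ _ limG); last exact: cvg_cst.
near=> t.
have t1 : 1 <= t by near: t; exact: nbhs_pinfty_ge.
rewrite /= H0 ?(lt_le_trans ltr01) //=.
by rewrite expRN ler_pdivlMr ?expR_gt0 // Gle.
Unshelve. all: by end_near.
Qed.

Lemma dotv_cvg0 (R : realType) (d : nat) (u : R -> 'cV[R]_d) :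
  dotv (u t) (u t) @[t --> +oo] --> 0 -> u t @[t --> +oo] --> (0 : 'cV[R]_d).
Proof.
move=> /cvgr0Pnorm_le h; apply/cvgr0Pnorm_le => e e0.
have := h _ (exprn_gt0 2 e0); apply: filterS => t.
rewrite ger0_norm ?dotv_ge0 // => ut.
rewrite [X in X <= _]/Num.Def.normr /= mx_normrE.
rewrite (bigmax_le _ (ltW e0)) // => -[i j] _ /=.
rewrite ord1 -ler_sqr ?nnegrE ?normr_ge0 ?(ltW e0) // real_normK ?num_real //.
apply: le_trans ut; rewrite /dotv (bigD1 i) //= expr2 lerDl.
by apply: sumr_ge0 => k _; rewrite -expr2 sqr_ge0.
Qed.

Lemma is_derive_grad (R : realType) (d : nat) (U : 'cV[R]_d -> R)
    (q : R -> 'cV[R]_d) (p : 'cV[R]_d) (t : R) :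
  differentiable (U : 'cV[R]_d -> R^o) (q t) ->
  is_derive (t : R^o) 1 (q : R^o -> 'cV[R]_d) p ->
  is_derive (t : R^o) 1 (fun s : R^o => U (q s) : R^o) (dotv (grad U (q t)) p).
Proof.
move=> dU [dq qp].
have qd : differentiable (q : R^o -> _) t by apply/derivable1_diffP.
have cd := differentiable_comp qd dU.
apply: DeriveDef; first exact/derivable1_diffP.
rewrite deriveE // diff_comp //= -[X in 'd U _ X]deriveE // qp.
rewrite {1}(matrix_sum_delta p) linear_sum /dotv; apply: eq_bigr => i _.
by rewrite big_ord1 linearZ mxE deriveE // mulrC.
Qed.

(** The proof is the Lyapunov argument sketched above.  The coefficient
    gamma / 2 of <q, p> in H makes the friction act equally on |p|^2 and on
    <F(q), q>, and gamma ^ 2 / 4 then cancels <q, p> in the derivative. *)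
Theorem force_assumption_stable (R : realType) (d : nat) (gamma : R)
    (F : 'cV[R]_d -> 'cV[R]_d) :
  0 < gamma -> force_assumption F gamma -> asymptotically_stable F gamma.
Proof.
move=> g0 [U [l [alpha [beta [U0 [[dU _] _] [al0 /andP[be0 beg]] FE Fq]]]]].
move=> x X [_ dX] _.
pose q t := (X t).1; pose p t := (X t).2.
have dq t (t0 : 0 < t) : is_derive (t : R^o) 1 (q : R^o -> _) (p t) := (dX t t0).1.
have dp t (t0 : 0 < t) : is_derive (t : R^o) 1 (p : R^o -> _)
    (- F (q t) - gamma *: p t) := (dX t t0).2.
pose H t := U (q t) + 2^-1 * dotv (p t) (p t)
  + (gamma / 2) * dotv (q t) (p t) + (gamma ^+ 2 / 4) * dotv (q t) (q t).
pose dH t := - dotv (l (q t)) (p t) - gamma / 2 * dotv (p t) (p t)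
  - gamma / 2 * dotv (F (q t)) (q t).
have H'E t : 0 < t -> is_derive (t : R^o) 1 (H : R^o -> R^o) (dH t).
  move=> t0.
  have h := is_deriveD (is_deriveD (is_deriveD
      (is_derive_grad (dU (q t)) (dq t t0))
      (is_deriveZ 2^-1 (is_derive_dotv (dp t t0) (dp t t0))))
    (is_deriveZ (gamma / 2) (is_derive_dotv (dq t t0) (dp t t0))))
    (is_deriveZ (gamma ^+ 2 / 4) (is_derive_dotv (dq t t0) (dq t t0))).
  apply: is_derive_eq h _.
  rewrite /GRing.scale /= /dH.
  rewrite [dotv (p t) (q t)]dotvC [dotv (p t) (- _ - _)]dotvC.
  rewrite [dotv (q t) (- _ - _)]dotvC !dotvDl !dotvNl !dotvZl [dotv (p t) (q t)]dotvC.
  have -> : dotv (F (q t)) (p t) = dotv (grad U (q t)) (p t) + dotv (l (q t)) (p t).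
    by rewrite FE dotvDl.
  by field.
(* H - U is a positive definite quadratic form in (q, p): both bounds come from
   completing a square. *)
have Hlow t : dotv (p t) (p t) <= 4 * H t /\ gamma ^+ 2 * dotv (q t) (q t) <= 8 * H t.
  have Uq := U0 (q t).
  have h1 := dotv_ge0 (p t + gamma *: q t).
  have h2 := dotv_ge0 (2 *: p t + gamma *: q t).
  move: h1 h2; rewrite /H !dotvDl !dotvDr !dotvZl !dotvZr [dotv (p t) (q t)]dotvC.
  move: Uq (dotv_ge0 (p t)) (dotv_ge0 (q t)).
  by split; lra.
(* m is the dissipation left over for |p|^2 and for |q|^2 + U; the sum
   1 + gamma + gamma ^ 2 majorizes every coefficient of H once <q, p> is bounded
   by (|q|^2 + |p|^2) / 2. *)
pose m := Num.min ((gamma - beta) / 2) (gamma / 2 * alpha).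
pose lam := m / (1 + gamma + gamma ^+ 2).
have K0 : 0 < 1 + gamma + gamma ^+ 2 by rewrite !addr_gt0 ?exprn_gt0.
have m0 : 0 < m by rewrite /m lt_min !mulr_gt0 ?subr_gt0.
have lam0 : 0 < lam by rewrite divr_gt0.
have dHle t : dH t <= - lam * H t.
  pose pp := dotv (p t) (p t); pose qq := dotv (q t) (q t).
  pose ll := dotv (l (q t)) (l (q t)) / beta ^+ 2.
  have Uq := U0 (q t).
  have pp0 : 0 <= pp := dotv_ge0 _.
  have qq0 : 0 <= qq := dotv_ge0 _.
  have ll0 : 0 <= ll by rewrite divr_ge0 ?sqr_ge0 ?dotv_ge0.
  (* Young's inequality with weight beta produces the term |l|^2 / beta^2 of the
     assumption, and leaves the positive factor gamma - beta in front of |p|^2. *)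
  have lp : - dotv (l (q t)) (p t) <= beta / 2 * (ll + pp).
    have : 0 <= beta / 2 * dotv (beta^-1 *: l (q t) + p t) (beta^-1 *: l (q t) + p t).
      by rewrite mulr_ge0 ?dotv_ge0 // divr_ge0 // ltW.
    rewrite !dotvDl !dotvDr !dotvZl !dotvZr [dotv (p t) (l _)]dotvC.
    move=> sq; rewrite -subr_ge0; apply: le_trans sq _; rewrite le_eqVlt.
    by apply/orP; left; apply/eqP; rewrite /ll /pp; field; exact: lt0r_neq0.
  have qp : dotv (q t) (p t) <= 2^-1 * (pp + qq).
    have := dotv_ge0 (q t - p t).
    rewrite !dotvDl !dotvDr !dotvNl !dotvNr [dotv (p t) (q t)]dotvC -/pp -/qq; lra.
  have Fqt : alpha * (qq + U (q t)) + ll <= dotv (F (q t)) (q t).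
    by have := Fq (q t); rewrite !enorm_sqr.
  have HK : H t <= (1 + gamma + gamma ^+ 2) * (pp + qq + U (q t)).
    rewrite /H -/pp -/qq; move: (sqr_ge0 gamma) => g2; nra.
  have m1 : m <= (gamma - beta) / 2 by rewrite /m ge_min lexx.
  have m2 : m <= gamma / 2 * alpha by rewrite /m ge_min lexx orbT.
  have lamH : lam * H t <= m * (pp + qq + U (q t)).
    apply: le_trans (ler_wpM2l (ltW lam0) HK) _.
    by rewrite mulrA divfK ?lt0r_neq0.
  have h1 : m * pp <= (gamma - beta) / 2 * pp by rewrite ler_wpM2r.
  have h2 : m * (qq + U (q t)) <= gamma / 2 * alpha * (qq + U (q t)).
    by rewrite ler_wpM2r // addr_ge0.
  have h3 : 0 <= (gamma - beta) / 2 * ll.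
    by rewrite mulr_ge0 // divr_ge0 // subr_ge0 ltW.
  have h4 : gamma / 2 * (alpha * (qq + U (q t)) + ll) <= gamma / 2 * dotv (F (q t)) (q t).
    by rewrite ler_wpM2l // divr_ge0 // ltW.
  rewrite /dH -/pp; lra.
have H0 t : 0 <= H t.
  have [+ _] := Hlow t; have := dotv_ge0 (p t); lra.
have Hlim : H t @[t --> +oo] --> 0.
  by apply: (gronwall_cvg0 lam0 H'E) => // t _.
have plim : p t @[t --> +oo] --> (0 : 'cV[R]_d).
  apply: dotv_cvg0; apply: (@squeeze_cvgr _ _ _ _ (cst 0) (fun t => 4 * H t)).
  - by apply: nearW => t; rewrite /= dotv_ge0; case: (Hlow t).
  - exact: cvg_cst.
  - by rewrite -(mulr0 4); exact: cvgMl_tmp.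
have qlim : q t @[t --> +oo] --> (0 : 'cV[R]_d).
  apply: dotv_cvg0; apply: (@squeeze_cvgr _ _ _ _ (cst 0)
    (fun t => 8 / gamma ^+ 2 * H t)).
  - apply: nearW => t; rewrite /= dotv_ge0; case: (Hlow t) => _ hq.
    by rewrite mulrAC ler_pdivlMr ?exprn_gt0 // mulrC.
  - exact: cvg_cst.
  - by rewrite -(mulr0 (8 / gamma ^+ 2)); exact: cvgMl_tmp.
rewrite (_ : X = fun t => (q t, p t)); first exact: (cvg_pair qlim plim).
by apply/funext => t; rewrite /q /p -surjective_pairing.
Qed.

(** * Spectral decomposition of a real normal matrix *)

(** The equation M z = (a + ib) z for z = x + iy, split into real and imaginary
    parts. *)
Definition eigenpair (R : realType) (d : nat) (M : 'M[R]_d) (a b : R)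
    (x y : 'cV[R]_d) : Prop :=
  M *m x = a *: x - b *: y /\ M *m y = a *: y + b *: x.

(** Multiplying the eigenvector by -i. *)
Lemma eigenpair_rot (R : realType) (d : nat) (M : 'M[R]_d) (a b : R)
    (x y : 'cV[R]_d) : eigenpair M a b x y -> eigenpair M a b y (- x).
Proof.
move=> [Mx My]; split; first by rewrite scalerN opprK.
by rewrite mulmxN Mx scalerN opprB addrC.
Qed.

Lemma Re_sum (R : realType) (I : finType) (z : I -> R[i]) :
  complex.Re (\sum_j z j) = \sum_j complex.Re (z j).
Proof. by elim/big_rec2: _ => // j a b _ <-; case: (z j); case: b. Qed.

Lemma Im_sum (R : realType) (I : finType) (z : I -> R[i]) :
  complex.Im (\sum_j z j) = \sum_j complex.Im (z j).
Proof. by elim/big_rec2: _ => // j a b _ <-; case: (z j); case: b. Qed.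

Lemma Re_mulr (R : realType) (z : R[i]) (c : R) :
  complex.Re (z * c%:C%C) = c * complex.Re z.
Proof. by case: z => u v /=; ring. Qed.

Lemma Im_mulr (R : realType) (z : R[i]) (c : R) :
  complex.Im (z * c%:C%C) = c * complex.Im z.
Proof. by case: z => u v /=; ring. Qed.

Section Spectral.
Local Open Scope sesquilinear_scope.

(** The vectors x i + i y i are the rows of the unitary matrix that diagonalizes M
    over the complex numbers.  Such a row is an eigenvector of M^T, and of the
    adjoint of M^T, which is M since M is real, with the conjugate eigenvalue;
    hence the opposite sign of b.  The last clause is the real part of
    Parseval's identity for that orthonormal basis. *)
Lemma normal_real_spectral (R : realType) (d : nat) (M : 'M[R]_d)
    (hM : M *m M^T = M^T *m M) :
  exists (a b : 'I_d -> R) (x y : 'I_d -> 'cV[R]_d),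
  [/\ forall i, eigenpair M (a i) (b i) (x i) (y i),
      forall i, eigenpair M^T (a i) (- b i) (x i) (y i),
      forall i, dotv (x i) (x i) + dotv (y i) (y i) = 1 &
      forall u v, dotv u v =
        \sum_i (dotv u (x i) * dotv v (x i) + dotv u (y i) * dotv v (y i))].
Proof.
pose A : 'M[R[i]]_d := map_mx (real_complex R) M.
have At : A ^t* = map_mx (real_complex R) M^T.
  by apply/matrixP => i j; rewrite !mxE; simpc.
have An : A \is normalmx.
  by apply/normalmxP; rewrite At -!map_mxM hM.
have /orthomx_spectralP := An.
set P := spectralmx A; set D := spectral_diag A => AE.
have Pu : P \is unitarymx := spectral_unitarymx A.
have PA : P *m A = diag_mx D *m P.
  by rewrite {1}AE !mulmxA mulmxV ?unitarymx_unit// mul1mx.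
have AtE : A ^t* = P ^t* *m diag_mx (map_mx Num.conj D) *m P.
  rewrite {1}AE invmx_unitary // !trmx_mul !map_mxM tr_diag_mx trmxCK.
  by rewrite map_diag_mx mulmxA.
have PAt : P *m A ^t* = diag_mx (map_mx Num.conj D) *m P.
  by rewrite AtE !mulmxA (unitarymxP Pu) mul1mx.
have PP : P ^t* *m P = 1%:M by rewrite -invmx_unitary // mulVmx ?unitarymx_unit.
have {Pu}PP' := unitarymxP Pu.
clearbody P D.
exists (fun i => complex.Re (D 0 i)), (fun i => - complex.Im (D 0 i)),
  (fun i => \col_j complex.Re (P i j)), (fun i => \col_j complex.Im (P i j)).
have eM i k : \sum_j P i j * (M k j)%:C%C = (D 0 i)^* * P i k.
  move/matrixP/(_ i k): PAt; rewrite At mul_diag_mx !mxE => <-.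
  by apply: eq_bigr => j _; rewrite !mxE.
have eMt i k : \sum_j P i j * (M j k)%:C%C = D 0 i * P i k.
  move/matrixP/(_ i k): PA; rewrite mul_diag_mx !mxE => <-.
  by apply: eq_bigr => j _; rewrite !mxE.
(* Entry k of the eigenvector equation for row i, split into real and imaginary
   parts; it serves for both M and M^T. *)
have key (N : 'M[R]_d) (i : 'I_d) (l : R[i]) :
    (forall k, \sum_j P i j * (N k j)%:C%C = l * P i k) ->
    eigenpair N (complex.Re l) (complex.Im l)
      (\col_j complex.Re (P i j)) (\col_j complex.Im (P i j)).
  move=> Nl; split; apply/matrixP => k j; rewrite !ord1 !mxE.
    have /(congr1 (@complex.Re R)) := Nl k; rewrite Re_sum.
    under eq_bigr => m _ do rewrite Re_mulr.
    under [in X in _ -> X]eq_bigr => m _ do rewrite mxE.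
    by move=> ->; case: (l) (P i k) => u v [].
  have /(congr1 (@complex.Im R)) := Nl k; rewrite Im_sum.
  under eq_bigr => m _ do rewrite Im_mulr.
  under [in X in _ -> X]eq_bigr => m _ do rewrite mxE.
  by move=> ->; case: (l) (P i k) => u v [].
have ReJ (z : R[i]) : complex.Re z^* = complex.Re z by case: z.
have ImJ (z : R[i]) : complex.Im z^* = - complex.Im z by case: z.
split.
- by move=> i; have := key _ _ _ (eM i); rewrite ReJ ImJ.
- move=> i; rewrite opprK; apply: key => k; rewrite -eMt.
  by apply: eq_bigr => j _; rewrite mxE.
- move=> i; have /matrixP/(_ i i)/(congr1 (@complex.Re R)) := PP'.
  rewrite !mxE eqxx /= Re_sum -big_split /= => <-; apply: eq_bigr => j _.
  by rewrite !mxE; case: (P i j) => u v /=; ring.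
move=> u v.
have PPe j k : \sum_i (complex.Re (P i j) * complex.Re (P i k)
     + complex.Im (P i j) * complex.Im (P i k)) = (j == k)%:R.
  have /matrixP/(_ j k)/(congr1 (@complex.Re R)) := PP.
  rewrite !mxE Re_sum => /esym; have -> : complex.Re ((j == k)%:R : R[i]) = (j == k)%:R.
    by case: (j == k).
  move=> ->; apply: eq_bigr => i _; rewrite !mxE.
  by case: (P i j) (P i k) => ? ? [? ?] /=; ring.
rewrite /dotv.
under [RHS]eq_bigr => i _.
  rewrite !big_distrlr -big_split /=.
  under eq_bigr => j _ do (rewrite -big_split /=;
    under eq_bigr => k _ do rewrite !mxE).
  over.
rewrite exchange_big /=; apply: eq_bigr => j _.
rewrite exchange_big /= (bigD1 j) //= [X in _ = _ + X]big1 ?addr0 => [|k kj].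
  rewrite (eq_bigr (fun i => u j 0 * v j 0 * (complex.Re (P i j) * complex.Re (P i j)
     + complex.Im (P i j) * complex.Im (P i j)))) => [|i _]; last by ring.
  by rewrite -mulr_sumr PPe eqxx mulr1.
rewrite (eq_bigr (fun i => u j 0 * v k 0 * (complex.Re (P i j) * complex.Re (P i k)
     + complex.Im (P i j) * complex.Im (P i k)))) => [|i _]; last by ring.
by rewrite -mulr_sumr PPe eq_sym (negbTE kj) mulr0.
Qed.
End Spectral.

(** * Explicit solutions on a complex eigenline *)

(** The two equations say that s + iw is a root of X ^ 2 + gamma X + (a + ib).  The
    imaginary one gives w = - b / (2 s + gamma), after which the real one becomes
    a quartic equation in s.  That quartic is nonpositive at 0 exactly when
    gamma ^ 2 * a <= b ^ 2, and nonnegative for large s, so the intermediate value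
    theorem yields a root s >= 0. *)
Lemma unstable_char_root (R : realType) (gamma a b : R) :
  0 < gamma -> gamma ^+ 2 * a <= b ^+ 2 ->
  exists s w : R, [/\ 0 <= s, s ^+ 2 - w ^+ 2 + gamma * s + a = 0 &
    2 * s * w + gamma * w + b = 0].
Proof.
move=> g0 ab.
pose p : {poly R} := ('X ^+ 2 + gamma *: 'X + a%:P) * (2 *: 'X + gamma%:P) ^+ 2
   - (b ^+ 2)%:P.
pose v := `|b| / gamma.
have v0 : 0 <= v by rewrite divr_ge0 // ltW.
have bE : b ^+ 2 = v ^+ 2 * gamma ^+ 2.
  by rewrite -exprMn divfK ?gt_eqF // real_normK ?num_real.
(* At K the two factors of the quartic dominate v ^ 2 and gamma ^ 2, whose
   product is b ^ 2. *)
pose K := `|a| + v + 1.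
have aK : v ^+ 2 <= K ^+ 2 + gamma * K + a.
  have a0 : 0 <= `|a| := normr_ge0 a.
  have : - `|a| <= a by rewrite lerNl -normrN ler_norm.
  have K0 : 0 <= gamma * K by rewrite mulr_ge0 ?addr_ge0 // ltW.
  rewrite /K in K0 *; nra.
have K0 : 0 <= K by rewrite !addr_ge0.
have [s /andP[s0 _] /rootP ps] : exists2 s, s \in `[0, K] & root p s.
  apply: poly_ivt => //; rewrite !hornerE /= !expr0n /= ?mulr0 ?add0r.
  rewrite -!(mulrA _ gamma) -!(mulrA _ (_ + gamma)) -!expr2.
  by rewrite subr_le0 mulrC ab /= subr_ge0 bE ler_pM ?sqr_ge0 //
    lerXn2r ?nnegrE ?addr_ge0 ?lerDr ?mulr_ge0 // ltW.
have sg : 0 < 2 * s + gamma by rewrite ltr_wpDl // mulr_ge0.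
exists s, (- b / (2 * s + gamma)); split => //; last first.
  by field; rewrite gt_eqF.
move: ps; rewrite /p !hornerE /= => /eqP; rewrite subr_eq0 => /eqP ps.
by rewrite exprMn sqrrN exprVn -ps; field; rewrite gt_eqF.
Qed.

Lemma is_derive_lincomb (R : realFieldType) (d : nat) (f g : R -> R)
    (df dg t : R) (x y : 'cV[R]_d) :
  is_derive (t : R^o) 1 (f : R^o -> R^o) df -> is_derive (t : R^o) 1 (g : R^o -> R^o) dg ->
  is_derive (t : R^o) 1 (fun s : R^o => f s *: x - g s *: y) (df *: x - dg *: y).
Proof.
move=> fd gd; apply/is_derive_mxP => i j.
rewrite (_ : (fun s => _) = (x i j *: (f : R^o -> R^o)) - (y i j *: (g : R^o -> R^o))).
  by apply: is_derive_eq; rewrite !mxE ![x i j *: _]mulrC ![y i j *: _]mulrC.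
by apply/funext => s; rewrite !mxE /= mulrC [g s * _]mulrC.
Qed.

Section ExplicitSolution.
Variables (R : realType) (d : nat) (s w : R).

Let f (t : R) : R := expR (s * t) * cos (w * t).
Let g (t : R) : R := expR (s * t) * sin (w * t).

Let df t : is_derive (t : R^o) 1 (f : R^o -> R^o) (s * f t - w * g t).
Proof.
have h1 := is_derive1_comp (is_derive_expR (s * t)) (is_derive_mull s t).
have h2 := is_derive1_comp (is_derive_cos (w * t)) (is_derive_mull w t).
apply: is_derive_eq (is_deriveM h1 h2) _.
by rewrite /f /g /GRing.scale /=; ring.
Qed.

Let dg t : is_derive (t : R^o) 1 (g : R^o -> R^o) (s * g t + w * f t).
Proof.
have h1 := is_derive1_comp (is_derive_expR (s * t)) (is_derive_mull s t).
have h2 := is_derive1_comp (is_derive_sin (w * t)) (is_derive_mull w t).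
apply: is_derive_eq (is_deriveM h1 h2) _.
by rewrite /f /g /GRing.scale /=; ring.
Qed.

(** The position is the real part of exp((s + iw) t) (x + iy), and the momentum is
    its derivative. *)
Definition spiral (x y : 'cV[R]_d) (t : R) : 'cV[R]_d * 'cV[R]_d :=
  (f t *: x - g t *: y, (s * f t - w * g t) *: x - (s * g t + w * f t) *: y).

Lemma spiral_trajectory (F : 'cV[R]_d -> 'cV[R]_d) (M : 'M[R]_d)
    (gamma a b : R) (x y : 'cV[R]_d) :
  s ^+ 2 - w ^+ 2 + gamma * s + a = 0 ->
  2 * s * w + gamma * w + b = 0 ->
  (forall q, F q = M *m q) ->
  eigenpair M a b x y ->
  trajectory F gamma (spiral x y).
Proof.
move=> re0 im0 hF [Mx My].
have d1 t : is_derive (t : R^o) 1 (fun u : R^o => (spiral x y u).1) (spiral x y t).2.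
  exact: is_derive_lincomb.
have d2 t : is_derive (t : R^o) 1 (fun u : R^o => (spiral x y u).2)
    (- F (spiral x y t).1 - gamma *: (spiral x y t).2).
  have ff : is_derive (t : R^o) 1 ((fun u => s * f u - w * g u) : R^o -> R^o)
     (s * (s * f t - w * g t) - w * (s * g t + w * f t)).
    exact: (is_deriveB (is_deriveZ s (df t)) (is_deriveZ w (dg t))).
  have gg : is_derive (t : R^o) 1 ((fun u => s * g u + w * f u) : R^o -> R^o)
     (s * (s * g t + w * f t) + w * (s * f t - w * g t)).
    exact: (is_deriveD (is_deriveZ s (dg t)) (is_deriveZ w (df t))).
  apply: is_derive_eq (is_derive_lincomb _ _ ff gg) _.
  rewrite hF mulmxBr -!scalemxAr Mx My.
  apply/matrixP => i j; rewrite !mxE.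
  have -> : a = - (s ^+ 2 - w ^+ 2 + gamma * s).
    by apply/eqP; rewrite -addr_eq0 addrC re0.
  have -> : b = - (2 * s * w + gamma * w).
    by apply/eqP; rewrite -addr_eq0 addrC im0.
  ring.
split=> [|t _]; last by split.
have c1 : continuous (fun u => (spiral x y u).1).
  move=> t; apply: (@differentiable_continuous _ R^o).
  by apply/derivable1_diffP; case: (d1 t).
have c2 : continuous (fun u => (spiral x y u).2).
  move=> t; apply: (@differentiable_continuous _ R^o).
  by apply/derivable1_diffP; case: (d2 t).
by apply: continuous_subspaceT => t; exact: (cvg_pair (c1 t) (c2 t)).
Qed.

(** The second spiral is the real part of exp((s + iw) t) (y - ix), that is the
    imaginary part of exp((s + iw) t) (x + iy).  Either squared norm may
    oscillate with t; the oscillating terms cancel in the sum. *)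
Lemma spiral_growth (x y : 'cV[R]_d) (t : R) :
  dotv (spiral x y t).1 (spiral x y t).1
    + dotv (spiral y (- x) t).1 (spiral y (- x) t).1
  = expR (s * t) ^+ 2 * (dotv x x + dotv y y).
Proof.
rewrite /dotv -!big_split mulr_sumr; apply: eq_bigr => i _; rewrite !mxE /f /g.
rewrite -[RHS]mulr1 -(cos2Dsin2 (w * t)) /=; ring.
Qed.

End ExplicitSolution.

(** * Stability implies the force assumption *)

Lemma cvg0_dotv (R : realType) (d : nat) (u : R -> 'cV[R]_d) :
  u t @[t --> +oo] --> (0 : 'cV[R]_d) -> dotv (u t) (u t) @[t --> +oo] --> 0.
Proof.
move=> u0; have -> : (0 : R) = \sum_(i < d) 0 by rewrite big1.
apply: (@cvg_big _ _ _ _ _ _ _ +oo) => [|i _]; first exact: add_continuous.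
have ui : u t i 0 @[t --> +oo] --> (0 : R).
  have c0 := @coord_continuous R d 1 i 0 (0 : 'cV[R]_d).
  rewrite (_ : 0 = (0 : 'cV[R]_d) i 0); last by rewrite mxE.
  exact: (@cvg_comp _ _ _ u (fun M : 'cV[R]_d => M i 0) _ _ _ u0 c0).
have h := cvgM ui ui; rewrite mulr0 in h.
exact: h.
Qed.

(** The bound b ^ 2 < gamma ^ 2 * a is the Routh-Hurwitz criterion for both roots of
    X ^ 2 + gamma X + (a + ib) to have negative real part.  Were it to fail, the two
    spirals through the eigenvector would tend to 0 while the sum of their
    squared norms stays at least 1. *)
Lemma stable_spectrum (R : realType) (d : nat) (gamma : R)
    (F : 'cV[R]_d -> 'cV[R]_d) (M : 'M[R]_d) (a b : R) (x y : 'cV[R]_d) :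
  0 < gamma -> (forall q, F q = M *m q) ->
  asymptotically_stable F gamma ->
  eigenpair M a b x y ->
  dotv x x + dotv y y = 1 ->
  b ^+ 2 < gamma ^+ 2 * a.
Proof.
move=> g0 hF stab Mxy xy; rewrite ltNge; apply/negP => ab.
have [s [w [s0 re0 im0]]] := unstable_char_root g0 ab.
have tends X : trajectory F gamma X -> dotv (X t).1 (X t).1 @[t --> +oo] --> 0.
  move=> tX; apply: (@cvg0_dotv _ _ (fun t => (X t).1)).
  have fc : z.1 @[z --> ((0, 0) : 'cV[R]_d * 'cV[R]_d)] --> (0 : 'cV[R]_d).
    exact: (@cvg_fst _ _ (nbhs (0 : 'cV[R]_d)) (nbhs (0 : 'cV[R]_d))).
  exact: (@cvg_comp _ _ _ X fst _ _ _ (stab (X 0) X tX erefl) fc).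
have lim := cvgD (tends _ (spiral_trajectory re0 im0 hF Mxy))
  (tends _ (spiral_trajectory re0 im0 hF (eigenpair_rot Mxy))).
rewrite addr0 in lim; have h := (cvgr0Pnorm_lt _).1 (lim _) 1 ltr01.
near (pinfty_nbhs R) => t.
have : `|dotv (spiral s w x y t).1 (spiral s w x y t).1
   + dotv (spiral s w y (- x) t).1 (spiral s w y (- x) t).1| < 1.
  by near: t; exact: h.
rewrite spiral_growth // xy mulr1 ger0_norm ?sqr_ge0 // ltNge exprn_ege1 //.
rewrite -expR0 ler_expR mulr_ge0 //; near: t; exact: nbhs_pinfty_ge.
Unshelve. all: by end_near.
Qed.

(** In the coordinates of the eigenbasis, <M q, q> and |l|^2 are the sums of
    a i and b i ^ 2 against the squared moduli N i of the coordinates of q, so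
    the claim holds term by term.  The constant c also multiplies <M q, q>: this
    margin leaves room, in the force assumption, both for alpha U and for
    replacing gamma by a smaller beta. *)
Lemma normal_coercive (R : realType) (d : nat) (gamma : R) (M : 'M[R]_d)
    (a b : 'I_d -> R) (x y : 'I_d -> 'cV[R]_d) :
  0 < gamma ->
  (forall i, eigenpair M (a i) (b i) (x i) (y i)) ->
  (forall i, eigenpair M^T (a i) (- b i) (x i) (y i)) ->
  (forall u v, dotv u v =
    \sum_i (dotv u (x i) * dotv v (x i) + dotv u (y i) * dotv v (y i))) ->
  (forall i, b i ^+ 2 < gamma ^+ 2 * a i) ->
  exists2 c, 0 < c <= gamma ^+ 2 & forall q : 'cV[R]_d,
    let l := 2^-1 *: (M *m q - M^T *m q) in
    0 <= dotv (M *m q) q /\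
    c * (dotv q q + dotv (M *m q) q) + dotv l l <= gamma ^+ 2 * dotv (M *m q) q.
Proof.
move=> g0 Mxy Mt pars ab.
have gg : 0 < gamma ^+ 2 by rewrite exprn_gt0.
have a0 i : 0 < a i.
  by rewrite -(pmulr_rgt0 _ gg); apply: le_lt_trans (ab i); rewrite sqr_ge0.
have a1 i : 0 < 1 + a i by rewrite addr_gt0.
pose c := \big[Num.min/gamma ^+ 2]_i ((gamma ^+ 2 * a i - b i ^+ 2) / (1 + a i)).
have ci i : c * (1 + a i) <= gamma ^+ 2 * a i - b i ^+ 2.
  by rewrite -ler_pdivlMr //; exact: bigmin_le_cond.
exists c.
  rewrite bigmin_le_id andbT; apply: lt_bigmin => // i _.
  by rewrite divr_gt0 // subr_gt0.
move=> q l.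
pose N i := dotv q (x i) ^+ 2 + dotv q (y i) ^+ 2.
have N0 i : 0 <= N i by rewrite addr_ge0 ?sqr_ge0.
have Mqx i : dotv (M *m q) (x i) = a i * dotv q (x i) + b i * dotv q (y i).
  by rewrite -{1}[M]trmxK -dotv_mulmxr (Mt i).1 scaleNr opprK dotvDr !dotvZr.
have Mqy i : dotv (M *m q) (y i) = a i * dotv q (y i) - b i * dotv q (x i).
  by rewrite -{1}[M]trmxK -dotv_mulmxr (Mt i).2 scaleNr dotvDr dotvNr !dotvZr.
have Tqx i : dotv (M^T *m q) (x i) = a i * dotv q (x i) - b i * dotv q (y i).
  by rewrite -dotv_mulmxr (Mxy i).1 dotvDr dotvNr !dotvZr.
have Tqy i : dotv (M^T *m q) (y i) = a i * dotv q (y i) + b i * dotv q (x i).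
  by rewrite -dotv_mulmxr (Mxy i).2 dotvDr !dotvZr.
have qqE : dotv q q = \sum_i N i by rewrite pars.
have SE : dotv (M *m q) q = \sum_i a i * N i.
  by rewrite pars; apply: eq_bigr => i _; rewrite Mqx Mqy /N; ring.
have lE : dotv l l = \sum_i b i ^+ 2 * N i.
  rewrite pars; apply: eq_bigr => i _.
  by rewrite /l !dotvZl !dotvDl !dotvNl Mqx Mqy Tqx Tqy /N; field.
split; first by rewrite SE sumr_ge0 // => i _; rewrite mulr_ge0 // ltW.
rewrite qqE lE SE mulrDr !mulr_sumr -!big_split /=; apply: ler_sum => i _.
have := ler_wpM2r (N0 i) (ci i); lra.
Qed.

Lemma stable_force_assumption (R : realType) (d : nat) (gamma : R)
    (F : 'cV[R]_d -> 'cV[R]_d) (M : 'M[R]_d) :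
  0 < gamma -> (forall q, F q = M *m q) -> M *m M^T = M^T *m M ->
  asymptotically_stable F gamma -> force_assumption F gamma.
Proof.
move=> g0 hF hM stab.
have [a [b [x [y [Mxy Mt xy pars]]]]] := normal_real_spectral hM.
have ab i : b i ^+ 2 < gamma ^+ 2 * a i.
  exact: (stable_spectrum g0 hF stab (Mxy i) (xy i)).
have [c /andP[c0 cg] coer] := normal_coercive g0 Mxy Mt pars ab.
have gg : 0 < gamma ^+ 2 by rewrite exprn_gt0.
have be0 : 0 < gamma ^+ 2 - c / 2 by lra.
pose l q : 'cV[R]_d := (2^-1 *: (M - M^T)) *m q.
have lE q : l q = 2^-1 *: (M *m q - M^T *m q).
  by rewrite /l -scalemxAl mulmxBl.
(* beta ^ 2 = gamma ^ 2 - c / 2 spends half of the margin c on |l|^2 / beta^2;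
   the term alpha (|q|^2 + U) fits in the other half. *)
exists (quad M), l, (c / 2 / (gamma ^+ 2 - c / 2)), (Num.sqrt (gamma ^+ 2 - c / 2)).
have qE q : quad M q = 2^-1 * dotv (M *m q) q by rewrite /quad dotvC.
split.
- by move=> q; rewrite qE mulr_ge0 //; case: (coer q).
- by split; [exact: Ck_quad | exact: (Ck_linear 3 (mulmx (2^-1 *: (M - M^T))))].
- split; first by rewrite !divr_gt0.
  rewrite sqrtr_gt0 be0 /= -[ltRHS](gtr0_norm g0) -sqrtr_sqr ltr_sqrt //; lra.
- move=> q; rewrite hF grad_quad lE -scalerDr addrACA subrr addr0.
  by rewrite scalerDr -scalerDl [_ + _](_ : _ = 1) ?scale1r //; lra.
move=> q; rewrite !enorm_sqr sqr_sqrtr ?(ltW be0) // hF qE lE.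
case: (coer q) => S0 /=; set S := dotv (M *m q) q in S0 *.
set Q := dotv q q; set L := dotv (_ *: _) _ => h.
rewrite [c / 2 / _ * _]mulrAC -mulrDl.
rewrite ler_pdivrMr //.
have cQ : 0 <= c * Q by rewrite mulr_ge0 ?dotv_ge0 // ltW.
have cS : 0 <= c * S by rewrite mulr_ge0 // ltW.
lra.
Qed.

Theorem theorem2p5 (R : realType) (d : nat) (gamma : R)
    (F : 'cV[R]_d -> 'cV[R]_d) (M : 'M[R]_d)
    (hd : (1 <= d)%N) (hgamma : 0 < gamma)
    (hF : forall q : 'cV[R]_d, F q = M *m q)
    (hM : M *m M^T = M^T *m M) :
  asymptotically_stable F gamma <-> force_assumption F gamma.
Proof.
split; first exact: stable_force_assumption.
exact: force_assumption_stable.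
Qed.
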